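(* Let $(G,u)$ be a simple dimension group with order unit $u$ such that $\operatorname{Aff}S(G,u)$ is finite-dimensional, let $\tau\in S(G,u)$, and let $Z=\{\sigma\in S(G,u)\mid \ker\tau\subseteq\ker\sigma\}$. The following are equivalent: (i) $\tau$ is refinable; (ii) $Z$ is refinable; (iii) $Z$ is good; (iv) $Z$ is weakly good. Moreover, when these conditions hold, $G/\ker\tau$ (with the quotient ordering) is a simple dimension group; in particular it is unperforated.
   Context: $G$ is a partially ordered abelian group with positive cone $G^+$; an order unit is a nonzero $u\in G^+$ such that for each $g$ there is $N\in\mathbb{N}$ with $-Nu\le g\le Nu$; $G^{++}$ denotes the order units. $G$ is directed if every finite subset has an upper bound; simple if nonzero, directed and $G^+\setminus\{0\}=G^{++}$; unperforated if $mg\ge0$, $m\in\mathbb{N}$ implies $g\ge0$; Riesz interpolation: $g_i\le g'_j$ ($i,j\in\{1,2\}$) implies some $g$ with $g_i\le g\le g'_j$. A dimension group is directed, unperforated, with Riesz interpolation. A trace is a nonzero positive homomorphism $G\to\mathbb{R}$; $S(G,u)$ is the set of traces with $\tau(u)=1$ (compact convex in $\mathbb{R}^G$), and $\operatorname{Aff}S(G,u)$ is the real vector space of continuous affine real functions on $S(G,u)$. For the convex subgroup $\ker\tau$, $G/\ker\tau$ has positive cone $(G^++\ker\tau)/\ker\tau$. For nonempty $U\subseteq S(G,u)$: $U$ is refinable if whenever $a_1,a_2,b\in G^+$ satisfy $\sigma(a_1)+\sigma(a_2)=\sigma(b)$ for all $\sigma\in U$, there exist $a_1',a_2'\in G^+$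 with $a_1'+a_2'=b$ and $\sigma(a_i')=\sigma(a_i)$ for $i=1,2$ and all $\sigma\in U$; $U$ is weakly good if for any $a,b\in G^+\setminus\{0\}$ with $\inf_{\sigma\in U}(\sigma(b)-\sigma(a))>0$ there exists $a'\in G^+\setminus\{0\}$ with $a'<b$ and $\sigma(a')=\sigma(a)$ for all $\sigma\in U$; $U$ is good if for any $a\in G$ and $b\in G^+\setminus\{0\}$ with $\inf_{\sigma\in U}\sigma(a)>0$ and $\inf_{\sigma\in U}(\sigma(b)-\sigma(a))>0$ there exists $a'\in G^+\setminus\{0\}$ with $a'<b$ and $\sigma(a')=\sigma(a)$ for all $\sigma\in U$. A single trace $\tau$ is refinable if $\{\tau\}$ is. *)

(* Defs.v *)
From HB Require Import structures.
From mathcomp Require Import all_boot all_order all_algebra.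
From mathcomp Require Import all_classical all_reals all_analysis.

Set Implicit Arguments.
Unset Strict Implicit.
Unset Printing Implicit Defensive.

Import Order.TTheory GRing.Theory Num.Theory.
Import numFieldNormedType.Exports.

Local Open Scope classical_set_scope.
Local Open Scope ring_scope.

(* A partially ordered abelian group is a zmodType G together with its positive
   cone P : set G.  The order is not carried by the type, so that the same
   predicates apply to a quotient group with the image cone. *)

Section PartiallyOrderedGroups.
Context {G : zmodType}.
Implicit Types (P : set G) (a b g u : G).

Definition po_group P : Prop :=
  [/\ P 0,
      (forall a b, P a -> P b -> P (a + b)) &
      (forall a, P a -> P (- a) -> a = 0)].

Definition cone_le P a b : Prop := P (b - a).
Definition cone_lt P a b : Prop := cone_le P a b /\ a <> b.

Definition order_unit P u : Prop :=
  [/\ P u, u <> 0 &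
      forall g, exists N : nat,
        cone_le P (- (u *+ N)) g /\ cone_le P g (u *+ N)].

Definition directed P : Prop :=
  forall A : set G, finite_set A ->
    exists b, forall a, A a -> cone_le P a b.

Definition unperforated P : Prop :=
  forall (m : nat) g, (0 < m)%N -> P (g *+ m) -> P g.

Definition riesz_interpolation P : Prop :=
  forall a1 a2 b1 b2,
    cone_le P a1 b1 -> cone_le P a1 b2 ->
    cone_le P a2 b1 -> cone_le P a2 b2 ->
    exists g, [/\ cone_le P a1 g, cone_le P a2 g,
                  cone_le P g b1 & cone_le P g b2].

Definition simple_group P : Prop :=
  [/\ (exists g : G, g <> 0),
      directed P &
      P `\ 0 = [set v | order_unit P v]].

Definition dimension_group P : Prop :=
  [/\ po_group P, directed P, unperforated P & riesz_interpolation P].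

Definition simple_dimension_group P : Prop :=
  dimension_group P /\ simple_group P.

End PartiallyOrderedGroups.

Section Traces.
Context {R : realType} {G : zmodType}.
Implicit Types (P : set G) (u : G) (U : set (G -> R)).

Definition is_trace P (t : G -> R) : Prop :=
  [/\ {morph t : x y / x + y},
      (exists g, t g <> 0) &
      (forall g, P g -> 0 <= t g)].

(* S(G, u), inside R^G with the product topology *)
Definition trace_space P u : set {ptws G -> R} :=
  [set t : G -> R | is_trace P t /\ t u = 1].

(* The type trace_space P u carries the subspace topology.  In the affinity
   condition, r stands for the convex combination l s + (1 - l) t. *)
Definition aff P u : set (trace_space P u -> R) :=
  [set f | continuous f /\
    forall (s t r : trace_space P u) (l : R), 0 <= l <= 1 ->
      (forall g, \val r g = l * \val s g + (1 - l) * \val t g) ->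
      f r = l * f s + (1 - l) * f t].

Definition aff_finite_dimensional P u : Prop :=
  exists (n : nat) (F : 'I_n -> trace_space P u -> R),
    (forall i, aff (F i)) /\
    forall f, aff f ->
      exists c : 'I_n -> R, forall s, f s = \sum_(i < n) c i * F i s.

Definition refinable P U : Prop :=
  forall a1 a2 b, P a1 -> P a2 -> P b ->
    (forall s, U s -> s a1 + s a2 = s b) ->
    exists a1' a2',
      [/\ P a1', P a2', a1' + a2' = b &
          forall s, U s -> s a1' = s a1 /\ s a2' = s a2].

(* For U a set of normalized traces, s b - s a is bounded over s in U, so the
   infimum below is that of a nonempty bounded set whenever U is nonempty. *)
Definition weakly_good P U : Prop :=
  forall a b, (P `\ 0) a -> (P `\ 0) b ->
    0 < inf [set s b - s a | s in U] ->
    exists a', [/\ (P `\ 0) a', cone_lt P a' b &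
                   forall s, U s -> s a' = s a].

Definition good P U : Prop :=
  forall a b, (P `\ 0) b ->
    0 < inf [set s a | s in U] ->
    0 < inf [set s b - s a | s in U] ->
    exists a', [/\ (P `\ 0) a', cone_lt P a' b &
                   forall s, U s -> s a' = s a].

End Traces.

Section Kernel.
Context {R : realType} {G : zmodType}.

Definition ker (t : {additive G -> R}) : {pred G} := [pred g | t g == 0].

Lemma ker_zmod_closed (t : {additive G -> R}) : zmod_closed (ker t).
Proof.
split=> [|x y]; rewrite !inE ?raddf0 // => /eqP tx /eqP ty.
by rewrite raddfB tx ty subrr.
Qed.

HB.instance Definition _ (t : {additive G -> R}) :=
  GRing.isZmodClosed.Build G (ker t) (ker_zmod_closed t).

Definition ker_face (P : set G) (u : G) (t : {additive G -> R}) :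
    set (G -> R) :=
  [set s | trace_space P u s /\ [set` ker t] `<=` [set g | s g = 0]].

End Kernel.

Definition quotient_cone (G : zmodType) (P : set G) (H : zmodClosed G) :
    set (Quotient.quot H) :=
  [set \pi_(Quotient.quot H)%qT (p + h) | p in P & h in [set` H]].
Arguments quotient_cone {G} P H.

(* Main.v *)
Require Import Defs.
From HB Require Import structures.
From mathcomp Require Import all_boot all_order all_algebra.
From mathcomp Require Import all_classical all_reals all_analysis.
From mathcomp Require Import ring lra.

(* Let K be the kernel of tau.  The only hard implication is that refinability
   of tau makes Z good, and it reduces to P + K being unperforated: in that case
   an element g that is strictly positive on Z lies in P + K, since otherwise
   Zorn's lemma would extend the monoid generated by P + K and - g to a total
   preorder, whose order unit defines a state in Z that is nonpositive at g.
   Applied to a and b - a, this puts both in P + K, and refinability of tau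
   yields the decomposition of b required by goodness.
   If K = 0 there is nothing to prove about P + K.  If K <> 0 then P has no
   atom, so refinability and approximate division in G cut every k in K into a
   sum of arbitrarily small elements of K.  As the evaluations at elements of G
   span a finite-dimensional space, k is, on all states, a real combination of a
   bounded number of these pieces; rounding the coefficients divided by m gives
   k' in K with k - m k' small.  Hence if m g = p + k with p > 0, then
   m (g - k') = p + (k - m k') > 0, and g - k' is in P by unperforation of P. *)

Set Implicit Arguments.
Unset Strict Implicit.
Unset Printing Implicit Defensive.

Import Order.TTheory GRing.Theory Num.Theory.
Import numFieldNormedType.Exports.

Local Open Scope classical_set_scope.
Local Open Scope ring_scope.

(** * Identities in abelian groups *)

(* A reflexive decision procedure: [zmod] reduces an equation in a zmodType to
   integer equations between the coefficients of its atoms. *)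
Inductive zexpr : Type :=
  | ZVar of nat | ZZero | ZAdd of zexpr & zexpr | ZOpp of zexpr
  | ZMuln of zexpr & nat | ZMulz of zexpr & int.

Fixpoint zcoef (e : zexpr) (i : nat) : int :=
  match e with
  | ZVar j => if i == j then 1 else 0
  | ZZero => 0
  | ZAdd a b => zcoef a i + zcoef b i
  | ZOpp a => - zcoef a i
  | ZMuln a n => zcoef a i * n%:Z
  | ZMulz a z => zcoef a i * z
  end.

Fixpoint zcoef_eq (a b : zexpr) (n : nat) : Prop :=
  if n is m.+1 then zcoef a m = zcoef b m /\ zcoef_eq a b m else True.

Section AbelianIdentities.
Context {G : zmodType}.
Implicit Types (env : seq G) (e : zexpr).

Fixpoint zeval env e : G :=
  match e with
  | ZVar j => env`_j
  | ZZero => 0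
  | ZAdd a b => zeval env a + zeval env b
  | ZOpp a => - zeval env a
  | ZMuln a n => zeval env a *+ n
  | ZMulz a z => zeval env a *~ z
  end.

Lemma zevalE env e : zeval env e = \sum_(i < size env) env`_i *~ zcoef e i.
Proof.
elim: e => [j||a IHa b IHb|a IHa|a IHa n|a IHa z] /=; rewrite ?{}IHa ?{}IHb.
- have [jn|jn] := ltnP j (size env).
    rewrite (bigD1 (Ordinal jn)) //= eqxx mulr1z big1 ?addr0// => i.
    by rewrite -val_eqE /= => /negPf ->.
  rewrite nth_default// big1// => i _.
  by rewrite ltn_eqF// (leq_trans (ltn_ord i)).
- by rewrite big1.
- by rewrite -big_split; apply: eq_bigr => i _; rewrite mulrzDr.
- by rewrite -sumrN; apply: eq_bigr => i _; rewrite mulrNz.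
- by rewrite -sumrMnl; apply: eq_bigr => i _; rewrite pmulrn -mulrzA.
- by rewrite mulrz_suml; apply: eq_bigr => i _; rewrite -mulrzA.
Qed.

Lemma zcoef_eqP env a b :
  zcoef_eq a b (size env) -> zeval env a = zeval env b.
Proof.
move=> ab; rewrite !zevalE; apply: eq_bigr => i _; congr (_ *~ _).
move: (nat_of_ord i) (ltn_ord i) => j.
elim: (size env) ab => //= n IHn [abn abl].
by rewrite ltnS leq_eqVlt => /orP[/eqP->//|/IHn]; apply.
Qed.

End AbelianIdentities.

Ltac zatom x env :=
  let rec go l n :=
    lazymatch l with
    | nil => fail
    | x :: _ => n
    | _ :: ?t => go t (S n)
    end in go env O.

Ltac zatoms env t :=
  lazymatch t with
  | GRing.zero => env
  | GRing.add ?a ?b => let env' := zatoms env a in zatoms env' b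
  | GRing.opp ?a => zatoms env a
  | GRing.natmul ?a _ => zatoms env a
  | intmul ?a _ => zatoms env a
  | ?x => match constr:(tt) with
          | _ => let n := zatom x env in env
          | _ => constr:(x :: env)
          end
  end.

Ltac zquote env t :=
  lazymatch t with
  | GRing.zero => constr:(ZZero)
  | GRing.add ?a ?b =>
      let a' := zquote env a in let b' := zquote env b in constr:(ZAdd a' b')
  | GRing.opp ?a => let a' := zquote env a in constr:(ZOpp a')
  | GRing.natmul ?a ?n => let a' := zquote env a in constr:(ZMuln a' n)
  | intmul ?a ?z => let a' := zquote env a in constr:(ZMulz a' z)
  | ?x => let n := zatom x env in constr:(ZVar n)
  end.

Ltac zmod :=
  lazymatch goal with
  | |- @eq ?G ?a ?b =>
      let env := zatoms (@nil G) a in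
      let env := zatoms env b in
      let a' := zquote env a in
      let b' := zquote env b in
      refine (@zcoef_eqP _ env a' b' _);
      cbn [zcoef_eq zcoef size eqn eq_op]; rewrite /=; repeat split; ring
  end.

(** * Existence of states *)

Section States.
Context {R : realType} {G : zmodType}.
Implicit Types (Q M : set G) (u g h : G).

Definition submonoid Q := Q 0 /\ forall a b, Q a -> Q b -> Q (a + b).

Lemma submonoid_natmul Q a n : submonoid Q -> Q a -> Q (a *+ n).
Proof.
move=> [Q0 QD] Qa; elim: n => [|n IHn]; first by rewrite mulr0n.
by rewrite mulrS; exact: QD.
Qed.

Lemma submonoid_sum Q (s : seq G) :
  submonoid Q -> (forall x, x \in s -> Q x) -> Q (\sum_(x <- s) x).
Proof. by move=> [Q0 QD] Qs; rewrite big_seq; exact: big_ind. Qed.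

(** Read [M] as the positive cone of a preorder: properness says that no positive multiple of [u] is
    nonpositive, which leaves room for a state with value 1 at [u]. *)
Let proper u M := [/\ submonoid M & forall n, (0 < n)%N -> ~ M (- (u *+ n))].

(** A maximal proper [M] is total. If neither [h] nor [- h] could be adjoined, there would be
    relations [m + h *+ a = - (u *+ n)] and [m' - h *+ a' = - (u *+ n')]; eliminating [h] puts a
    negative multiple of [u] in [M]. *)
Lemma maximal_submonoid Q u : proper u Q ->
  exists M, [/\ proper u M, Q `<=` M & forall h, M h \/ M (- h)].
Proof.
move=> [[Q0 QD] Qu].
(* The order is on the sets [X] to be added to [Q], so that the empty chain, whose union is empty,
   is covered as well. *)
have [|A [pA maxA]] := @Zorn_bigcup G [set X | proper u (Q `|` X)].
  move=> F FP Ftot /=.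
  have chain x y : (Q `|` \bigcup_(X in F) X) x ->
      (Q `|` \bigcup_(X in F) X) y ->
      (Q x /\ Q y) \/ exists2 X, F X & (Q `|` X) x /\ (Q `|` X) y.
    move=> [Qx|[X FX Xx]] [Qy|[Y FY Yy]].
    - by left.
    - by right; exists Y => //; split; [left|right].
    - by right; exists X => //; split; [right|left].
    - have [XY|YX] := Ftot _ _ FX FY.
        by right; exists Y => //; split; right => //; exact: XY.
      by right; exists X => //; split; right => //; exact: YX.
  split; first split; first by left.
    move=> a b Ha Hb; have [[Qa Qb]|[X FX [Xa Xb]]] := chain _ _ Ha Hb.
      by left; exact: QD.
    have [[_ XD] _] := FP _ FX.
    by have [|Xab] := XD _ _ Xa Xb; [left|right; exists X].
  move=> n n0 [/Qu|[X FX Xn]]; first exact.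
  by have [_ /(_ n n0)] := FP _ FX; case; right.
exists (Q `|` A); split=> //.
have {maxA} maxM h : ~ (Q `|` A) h ->
    exists n m a, [/\ (0 < n)%N, (0 < a)%N, (Q `|` A) m &
                      m + h *+ a = - (u *+ n)].
  move=> Ah; apply: contrapT => noa.
  have [[M0 MD] Mu] := pA.
  pose B := [set x | exists m a, (Q `|` A) m /\ x = m + h *+ a].
  have QB : Q `|` B = B.
    apply/setUidPr => x Qx; exists x, 0%N; rewrite mulr0n addr0; split=> //.
    by left.
  apply: maxA (_ : proper u (Q `|` B)).
    split; last first.
      move=> /(_ h) BA; apply: Ah; right; apply: BA.
      by exists 0, 1%N; rewrite add0r.
    by move=> x Ax; exists x, 0%N; rewrite mulr0n addr0; split=> //; right.
  rewrite /= QB; split; first split.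
  - by exists 0, 0%N; rewrite add0r.
  - move=> _ _ [m [a [Mm ->]]] [m' [a' [Mm' ->]]].
    by exists (m + m'), (a + a')%N; split; [exact: MD|zmod].
  - move=> n n0 [m [[|a] [Mm e]]].
      by apply: (Mu n) => //; rewrite e mulr0n addr0.
    by apply: noa; exists n, m, a.+1.
move=> h; apply: contrapT => /not_orP[/maxM h1 /maxM h2].
have [n [m [a [n0 a0 Mm e]]]] := h1.
have [n' [m' [a' [n'0 a'0 Mm' e']]]] := h2.
have [Mmon Mu] := pA.
apply: (Mu (n * a' + n' * a)%N); first by rewrite addn_gt0 muln_gt0 n0 a'0.
have -> : - (u *+ (n * a' + n' * a)) = m *+ a' + m' *+ a.
  transitivity ((- (u *+ n)) *+ a' + (- (u *+ n')) *+ a); first by zmod.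
  by rewrite -e -e'; zmod.
by apply: Mmon.2; exact: submonoid_natmul.
Qed.

(** The state at [h] is the supremum of the rationals [p / q] with [u *~ p] below [h *+ q]. Such
    lower bounds add up, so [s] is superadditive; totality makes it odd, since a rational strictly
    between [s h] and [- s (- h)] would have to belong to one of the two cuts. *)
Lemma total_state M u : proper u M -> (forall h, M h \/ M (- h)) ->
  (forall h, exists N, M (u *+ N - h)) ->
  exists s : G -> R, [/\ {morph s : x y / x + y},
    (forall h, M h -> 0 <= s h) & s u = 1].
Proof.
move=> [Mmon Mu] Mtot Munit; have [M0 MD] := Mmon.
have Mz z : M (u *~ z) -> 0 <= z.
  case: z => // n; rewrite NegzE mulrNz => Mn.
  by case: (Mu n.+1).
pose A h := [set x : R | exists (p : int) (q : nat),
  [/\ (0 < q)%N, x = p%:~R / q%:R & M (h *+ q - u *~ p)]].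
have A0 h : A h !=set0.
  have [N MN] := Munit (- h).
  exists ((- N%:Z)%:~R / 1%:R), (- N%:Z), 1%N; split=> //.
  by suff -> : h *+ 1 - u *~ (- N%:Z) = u *+ N - - h by []; zmod.
have Aub h : has_ubound (A h).
  have [N MN] := Munit h.
  exists N%:R => _ [p [q [q0 -> Mhp]]].
  rewrite ler_pdivrMr ?ltr0n// -natrM -[(_ * _)%:R]/((N * q)%N%:Z%:~R).
  rewrite ler_int -subr_ge0; apply: Mz.
  have -> : u *~ ((N * q)%N%:Z - p) =
      (u *+ N - h) *+ q + (h *+ q - u *~ p) by zmod.
  by apply: MD => //; exact: submonoid_natmul.
have AD h k x y : A h x -> A k y -> A (h + k) (x + y).
  move=> [p [q [q0 -> Mp]]] [p' [q' [q'0 -> Mp']]].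
  exists (p * q'%:Z + p' * q%:Z), (q * q')%N; split.
  - by rewrite muln_gt0 q0.
  - rewrite intrD !intrM natrM -!pmulrn.
    by field; rewrite !pnatr_eq0 -!lt0n q0 q'0.
  - have -> : (h + k) *+ (q * q') - u *~ (p * q'%:Z + p' * q%:Z) =
        (h *+ q - u *~ p) *+ q' + (k *+ q' - u *~ p') *+ q by zmod.
    by apply: MD; exact: submonoid_natmul.
pose s h := sup (A h).
have sA h x : A h x -> x <= s h by exact: ub_le_sup.
have s_super h k : s h + s k <= s (h + k).
  rewrite -lerBrDr; apply: ge_sup => // x Ax.
  rewrite lerBrDr addrC -lerBrDr; apply: ge_sup => // y Ay.
  by rewrite lerBrDr addrC; apply: sA; exact: AD.
have s0 : s 0 = 0.
  apply/eqP; rewrite eq_le; apply/andP; split.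
    apply: ge_sup => // _ [p [q [q0 -> Mp]]].
    rewrite pmulr_lle0 ?invr_gt0 ?ltr0n// lerz0 -oppr_ge0; apply: Mz.
    by suff -> : u *~ (- p) = 0 *+ q - u *~ p by []; zmod.
  by apply: sA; exists 0, 1%N; split; rewrite ?mul0r// mul0rn mulr0z subr0.
have sN h : s (- h) = - s h.
  apply/eqP; rewrite -addr_eq0 eq_le; apply/andP; split.
    by rewrite -s0 -(addNr h).
  rewrite leNgt; apply/negP => sneg.
  have /rat_in_itvoo[r] : s h < - s (- h) by rewrite -subr_lt0 opprK addrC.
  rewrite in_itv/= => /andP[hr rh].
  pose q := `|denq r|%N.
  have q0 : (0 < q)%N by rewrite absz_gt0 denq_eq0.
  have rE : ratr r = (numq r)%:~R / q%:R :> R.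
    by rewrite /ratr /q natr_absz normr_denq.
  have [Mr|Mr] := Mtot (h *+ q - u *~ numq r).
    have /sA : A h (ratr r) by exists (numq r), q.
    by rewrite leNgt hr.
  have /sA : A (- h) (- ratr r).
    exists (- numq r), q; split=> //; first by rewrite rE intrN mulNr.
    by suff -> : (- h) *+ q - u *~ (- numq r) = - (h *+ q - u *~ numq r) by [];
      zmod.
  by rewrite lerNl leNgt rh.
have sD : {morph s : x y / x + y}.
  move=> h k; apply/eqP; rewrite eq_le s_super andbT.
  by have := s_super (h + k) (- k); rewrite addrK sN lerBlDr.
exists s; split=> //.
  move=> h Mh; apply: sA; exists 0, 1%N; split; rewrite ?mul0r//.
  by rewrite mulr0z subr0.
apply/eqP; rewrite eq_le; apply/andP; split.
  rewrite -[s u]opprK -sN lerNl; apply: sA; exists (- 1), 1%N; split=> //.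
    by rewrite divr1.
  by suff -> : (- u) *+ 1 - u *~ (-1) = 0 by []; zmod.
by apply: sA; exists 1, 1%N; split; rewrite ?divr1// subrr.
Qed.

Lemma state_exists Q u g : submonoid Q -> Q u ->
  (forall h, exists N, Q (u *+ N - h)) ->
  (forall n, (0 < n)%N -> ~ Q (g *+ n)) ->
  exists s : G -> R, [/\ {morph s : x y / x + y},
    (forall h, Q h -> 0 <= s h), s u = 1 & s g <= 0].
Proof.
move=> Qmon Qu Qunit Qg; have [Q0 QD] := Qmon.
pose Q' := [set x | exists q n, Q q /\ x = q - g *+ n].
have pQ' : proper u Q'.
  split; first split.
  - by exists 0, 0%N; split=> //; zmod.
  - move=> _ _ [q [n [Qq ->]]] [q' [n' [Qq' ->]]].
    by exists (q + q'), (n + n')%N; split; [exact: QD|zmod].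
  - move=> n n0 [q [[|k] [Qq e]]].
      (* Here [- (u *+ n)] itself lies in [Q]; so does [u *+ N + g], hence also [g *+ n], which [Qg]
         forbids. *)
      have [N QN] := Qunit (- g).
      apply: (Qg n) => //.
      have -> : g *+ n = (u *+ N - - g) *+ n + q *+ N.
        have -> : q = - (u *+ n) by rewrite e; zmod.
        by zmod.
      by apply: QD; exact: submonoid_natmul.
    apply: (Qg k.+1) => //.
    have -> : g *+ k.+1 = q + u *+ n.
      transitivity (q - - (u *+ n)); last by zmod.
      by rewrite e; zmod.
    by apply: QD => //; exact: submonoid_natmul.
have [M [pM pM' Mtot]] := maximal_submonoid pQ'.
have QM q : Q q -> M q.
  by move=> Qq; apply: pM'; exists q, 0%N; split=> //; zmod.
have [|s [sD s0 s1]] := total_state pM Mtot.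
  by move=> h; have [N /QM QN] := Qunit h; exists N.
exists s; split=> //; first by move=> h /QM /s0.
have s00 : s 0 = 0 by apply: (addrI (s 0)); rewrite -sD !addr0.
rewrite -oppr_ge0; have <- : s (- g) = - s g.
  by apply/eqP; rewrite -addr_eq0 -sD addNr s00.
by apply/s0/pM'; exists 0, 1%N; split=> //; rewrite sub0r.
Qed.

End States.

(** * Riesz decomposition in simple dimension groups *)

Section SimpleDimensionGroups.
Context {G : zmodType} {P : set G}.
Hypothesis dimP : simple_dimension_group P.
Implicit Types (a b e g p q x y : G) (s : seq G).

Lemma cone_submonoid : submonoid P.
Proof. by have [[[? ? _] _ _ _] _] := dimP. Qed.

Let Pmon := cone_submonoid.
Let P0 : P 0 := Pmon.1.
Let PD : forall a b, P a -> P b -> P (a + b) := Pmon.2.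
Let Pn a n : P a -> P (a *+ n). Proof. exact: submonoid_natmul. Qed.

Lemma cone_anti a : P a -> P (- a) -> a = 0.
Proof. by have [[[_ _ Panti]]] := dimP => *; exact: Panti. Qed.

Lemma cone_unperforated n a : (0 < n)%N -> P (a *+ n) -> P a.
Proof. by have [[_ _ Punp _] _] := dimP; exact: Punp. Qed.

Lemma cone_unit e g : P e -> e <> 0 -> exists N, P (e *+ N - g).
Proof.
have [_ [_ _ PE]] := dimP => Pe e0.
have : (P `\ 0) e by split.
by rewrite PE => -[_ _ /(_ g)[N [_ ?]]]; exists N.
Qed.

Lemma riesz_decomposition x a b : P x -> P a -> P b -> P (a + b - x) ->
  exists y z, [/\ x = y + z, P y, P z, P (a - y) & P (b - z)].
Proof.
move=> Px Pa Pb Pabx; have [[_ _ _ Pint] _] := dimP.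
have [||||y []] := Pint 0 (x - b) a x; rewrite /cone_le ?subr0//.
- by have -> : a - (x - b) = a + b - x by zmod.
- by have -> : x - (x - b) = b by zmod.
move=> Py Pyb ay xy; exists y, (x - y); split=> //; first by zmod.
by have -> : b - (x - y) = y - (x - b) by zmod.
Qed.

Lemma riesz_decomposition_natmul n x b : P x -> P b -> P (b *+ n - x) ->
  exists s, x = \sum_(y <- s) y /\ forall y, y \in s -> P y /\ P (b - y).
Proof.
move=> Px Pb; elim: n x Px => [|n IHn] x Px.
  by rewrite mulr0n sub0r => /(cone_anti Px) ->; exists [::]; rewrite big_nil.
rewrite mulrS => /(riesz_decomposition Px Pb (Pn n Pb)).
move=> [y [z [-> Py Pz yb /(IHn _ Pz)[s [-> sb]]]]].
exists (y :: s); rewrite big_cons; split=> // w.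
by rewrite inE => /orP[/eqP->|/sb].
Qed.

Lemma sum_ge_mem s x :
  (forall y, y \in s -> P y) -> x \in s -> P (\sum_(y <- s) y - x).
Proof.
move=> Ps xs; rewrite (perm_big _ (perm_to_rem xs)) big_cons addrAC subrr add0r.
by apply: submonoid_sum => // y /mem_rem /Ps.
Qed.

(** Since [e - x] is an order unit, [x] is a sum of positive pieces below [e - x]; a nonzero piece
    lies below both [x] and [e - x], hence twice below [e]. *)
Lemma halving e x : P x -> P (e - x) -> x <> 0 -> x <> e ->
  exists y, [/\ P y, y <> 0 & P (e - y *+ 2)].
Proof.
move=> Px Pex x0 xe.
have [|N PN] := @cone_unit (e - x) x Pex.
  by move=> /subr0_eq/esym.
have [s [xs sP]] := riesz_decomposition_natmul Px Pex PN.
have [y ys y0] : exists2 y, y \in s & y <> 0.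
  apply: contrapT => s0; apply: x0; rewrite xs big_seq big1// => y ys.
  by apply: contrapT => y0; apply: s0; exists y.
have [Py Pexy] := sP _ ys.
exists y; split=> //.
have -> : e - y *+ 2 = (e - x - y) + (x - y) by zmod.
by apply: PD => //; rewrite xs; apply: sum_ge_mem => // z /sP[].
Qed.

(** A translate of [g] by a multiple of [e] lies between 0 and a multiple of [e], so it splits into
    pieces below the atom [e], each of them 0 or [e]. *)
Lemma atom_generates e g : P e -> e <> 0 ->
  (forall x, P x -> P (e - x) -> x = 0 \/ x = e) -> exists z : int, g = e *~ z.
Proof.
move=> Pe e0 atom.
have [N PN] := @cone_unit e (- g) Pe e0.
have [M PM] := @cone_unit e g Pe e0.
have PgN : P (g + e *+ N) by rewrite addrC -[g]opprK.
have [|s [gs sP]] :=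
    @riesz_decomposition_natmul (M + N)%N (g + e *+ N) e PgN Pe.
  by have -> : e *+ (M + N) - (g + e *+ N) = e *+ M - g by zmod.
have [z sz] : exists z : int, \sum_(y <- s) y = e *~ z.
  elim: s sP {gs} => [|y s IHs] sP; first by exists 0; rewrite big_nil mulr0z.
  have [z sz] : exists z : int, \sum_(y <- s) y = e *~ z.
    by apply: IHs => w ws; apply: sP; rewrite inE ws orbT.
  have [|Py Pey] := sP y; first exact: mem_head.
  have [->|->] := atom _ Py Pey; rewrite big_cons sz.
    by exists z; rewrite add0r.
  by exists (1 + z); zmod.
exists (z - N%:Z); have -> : g = e *~ z - e *+ N; last by zmod.
by rewrite -sz -gs; zmod.
Qed.

Section Atomless.
Hypothesis atomless : forall e, P e -> e <> 0 ->
  exists x, [/\ P x, P (e - x), x <> 0 & x <> e].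

Lemma small_fraction n e : P e -> e <> 0 ->
  exists y, [/\ P y, y <> 0 & P (e - y *+ n)].
Proof.
move=> Pe e0.
suff [y [Py y0 Pey]] : exists y, [/\ P y, y <> 0 & P (e - y *+ n.+1)].
  exists y; split=> //; have -> : e - y *+ n = e - y *+ n.+1 + y by zmod.
  exact: PD.
elim: n => [|n [y [Py y0 Pey]]].
  by exists e; split=> //; rewrite subrr.
have [x [Px Pyx x0 xy]] := atomless Py y0.
have [z [Pz z0 Pyz]] := halving Px Pyx x0 xy.
(* From [n.+1] copies of [y] below [e] and two copies of [z] below [y] come [2 * n.+1] copies of
   [z], at least [n.+2]. *)
exists z; split=> //.
have -> : e - z *+ n.+2 =
    (e - y *+ n.+1) + (y - z *+ 2) *+ n.+1 + z *+ n by zmod.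
by apply: PD; [apply: PD => //; exact: Pn|exact: Pn].
Qed.

End Atomless.

(* Layers: [l.2] is the part of [e] which is covered [l.1] times by [p]. *)
Lemma add_to_layers (s : seq (nat * G)) q : P q ->
  (forall l, l \in s -> P l.2) -> P (\sum_(l <- s) l.2 - q) ->
  exists s' : seq (nat * G), [/\ forall l, l \in s' -> P l.2,
    \sum_(l <- s') l.2 = \sum_(l <- s) l.2 &
    \sum_(l <- s') l.2 *+ l.1 = \sum_(l <- s) l.2 *+ l.1 + q].
Proof.
elim: s q => [|[n y] s IHs] q Pq Ps.
  rewrite big_nil sub0r => /(cone_anti Pq) ->.
  by exists [::]; rewrite !big_nil addr0.
have Py : P y by apply: (Ps (n, y)); exact: mem_head.
have {}Ps l : l \in s -> P l.2 by move=> ls; apply: Ps; rewrite inE ls orbT.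
have Psum : P (\sum_(l <- s) l.2) by rewrite big_seq; exact: big_ind.
rewrite big_cons => /(riesz_decomposition Pq Py Psum).
move=> [a [b [-> Pa Pb Pya /(IHs _ Pb Ps)[s' [Ps' e1 e2]]]]].
(* The part [a] of the layer [y] that [q] covers rises by one level; the rest stays. *)
exists [:: (n, y - a), (n.+1, a) & s']; split.
- by move=> l; rewrite !inE => /or3P[/eqP->|/eqP->|/Ps'].
- by rewrite !big_cons e1 /=; zmod.
- by rewrite !big_cons e2 /=; zmod.
Qed.

Lemma layers p e N : P p -> P e -> P (e *+ N - p) ->
  exists s : seq (nat * G), [/\ forall l, l \in s -> P l.2,
    \sum_(l <- s) l.2 = e & \sum_(l <- s) l.2 *+ l.1 = p].
Proof.
move=> + Pe; elim: N p => [|N IHN] p Pp.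
  rewrite mulr0n sub0r => /(cone_anti Pp) ->.
  exists [:: (0%N, e)]; rewrite !big_seq1; split=> // l.
  by rewrite inE => /eqP->.
rewrite mulrS => /(riesz_decomposition Pp Pe (Pn N Pe)).
move=> [q [p' [-> Pq Pp' Peq /(IHN _ Pp')[s [Ps se <-]]]]].
have [|s' [Ps' e1 e2]] := add_to_layers Pq Ps; first by rewrite se.
by exists s'; rewrite e1 e2 addrC.
Qed.

(** Write [p] in layers over a small [y] with [y *+ m] below [e], and replace each multiplicity [l]
    by [l %/ m] plus one. Multiplied by [m], this exceeds [l] by at most [m], so the total excess is
    at most [y *+ m]. *)
Lemma approximate_division m p e :
  (forall e, P e -> e <> 0 -> exists x, [/\ P x, P (e - x), x <> 0 & x <> e]) ->
  (0 < m)%N -> P p -> P e -> e <> 0 ->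
  exists c, [/\ P c, P (c *+ m - p) & P (p + e - c *+ m)].
Proof.
move=> atomless m0 Pp Pe e0.
have [y [Py y0 Pey]] := small_fraction atomless m Pe e0.
have [N PN] := @cone_unit y p Py y0.
have [s [Ps sy sp]] := layers Pp Py PN.
have Psum (f : nat -> nat) : P (\sum_(l <- s) l.2 *+ f l.1).
  rewrite big_seq; apply: big_ind => // l ls; apply: Pn; exact: Ps.
exists (\sum_(l <- s) l.2 *+ (l.1 %/ m).+1); split.
- exact: (Psum (fun n => (n %/ m).+1)).
  suff -> : (\sum_(l <- s) l.2 *+ (l.1 %/ m).+1) *+ m - p =
      \sum_(l <- s) l.2 *+ (m - l.1 %% m).
    exact: (Psum (fun n => m - n %% m)%N).
  rewrite -sp -sumrMnl -sumrB; apply: eq_bigr => l _.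
  rewrite {2}(divn_eq l.1 m) mulrnBr; last by rewrite ltnW// ltn_pmod.
  by zmod.
suff -> : p + e - (\sum_(l <- s) l.2 *+ (l.1 %/ m).+1) *+ m =
    (e - y *+ m) + \sum_(l <- s) l.2 *+ (l.1 %% m).
  by apply: PD => //; exact: (Psum (fun n => n %% m)%N).
suff : p + y *+ m = (\sum_(l <- s) l.2 *+ (l.1 %/ m).+1) *+ m +
    \sum_(l <- s) l.2 *+ (l.1 %% m).
  by move=> /(canRL (addrK _)) ->; zmod.
rewrite -sp -sy -!sumrMnl -!big_split; apply: eq_bigr => l _ /=.
by rewrite {1}(divn_eq l.1 m); zmod.
Qed.

End SimpleDimensionGroups.

(** * The kernel of a refinable trace *)

Section Traces.
Context {R : realType} {G : zmodType} {P : set G} {u : G}.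
Hypotheses (dimP : simple_dimension_group P) (uP : order_unit P u).
Implicit Types (a b e g k p x y : G) (s : G -> R).

Let Pmon : submonoid P := cone_submonoid dimP.

Lemma trace_additive s : is_trace P s ->
  exists f : {additive G -> R}, s = f.
Proof.
move=> [sD _ _].
have s0 : s 0 = 0 by apply: (addrI (s 0)); rewrite -sD !addr0.
have sB : zmod_morphism s.
  move=> x y; rewrite sD; congr (_ + _); apply/eqP.
  by rewrite -addr_eq0 -sD addNr s0.
exists (HB.pack_for {additive G -> R} s
  (GRing.isZmodMorphism.Build G R s sB)).
by [].
Qed.

Lemma trace_gt0 s a : trace_space P u s -> P a -> a <> 0 -> 0 < s a.
Proof.
move=> [sT s1] Pa a0; have [_ _ s_ge0] := sT.
have [f sf] := trace_additive sT; rewrite {}sf in s1 s_ge0 *.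
have [N /s_ge0] := cone_unit dimP u Pa a0.
rewrite raddfB raddfMn s1 subr_ge0 => fN.
rewrite lt_def s_ge0// andbT; apply/eqP => fa0.
by rewrite fa0 mul0rn ler10 in fN.
Qed.

(** If [g] is not in [P], then by unperforation no positive multiple of it is, and [state_exists]
    yields a trace that is nonpositive at [g]. *)
Lemma positive_on_traces g :
  (forall s, trace_space P u s -> 0 < s g) -> P g.
Proof.
move=> g_gt0; apply: contrapT => Pg.
have [Pu u0 uu] := uP.
have [|n n0 Pgn|s [sD s0 s1 sg]] := @state_exists R G P u g Pmon Pu.
- by move=> h; have [N [_ ?]] := uu h; exists N.
- by apply: Pg; exact: cone_unperforated Pgn.
have /g_gt0 : trace_space P u s.
  by split=> //; split=> //; exists u; rewrite s1; apply/eqP/oner_neq0.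
by rewrite ltNge sg.
Qed.

(** Finite dimension enters through this lemma: evaluation at [g] is affine and continuous, hence a
    combination of the spanning family. *)
Lemma evaluation_coordinates : aff_finite_dimensional (R := R) P u ->
  exists n (c : G -> 'rV[R]_n) (F : 'I_n -> trace_space (R := R) P u -> R),
    forall g (s : trace_space P u), \val s g = \sum_i c g 0 i * F i s.
Proof.
move=> [n [F [_ span]]].
have ev g : exists c : 'rV[R]_n,
    forall s : trace_space P u, \val s g = \sum_i c 0 i * F i s.
  have [|c cE] := span (fun s : trace_space P u => \val s g).
    split; last by move=> s t r l _ ->.
    move=> s; apply: (@continuous_comp (trace_space P u) {ptws G -> R} R
      \val (fun t => t g)).
      exact: initial_continuous.
    exact: (@proj_continuous G (fun=> R) g).
  by exists (\row_i c i) => s; rewrite cE; apply: eq_bigr => i _; rewrite mxE.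
by have [c cE] := choice ev; exists n, c, F.
Qed.

(** The bound [n] depends on neither [t] nor [m]: at most [n] coordinate rows of elements of [t]
    span the others, so the sum of [t] is, on traces, a real combination of at most [n] of them.
    Dividing the coefficients by [m] and taking floors costs at most [s e *+ m] for each. *)
Lemma approximate_kernel_division : aff_finite_dimensional (R := R) P u ->
  exists n, forall (tau : {additive G -> R}) e (t : seq G) m,
    (0 < m)%N -> P e ->
    (forall x, x \in t -> [/\ tau x = 0, P (e - x) & P (e + x)]) ->
  exists k, tau k = 0 /\ forall s, trace_space P u s ->
    - (s e *+ (m * n)) <= s (\sum_(x <- t) x) - s k *+ m.
Proof.
move=> /evaluation_coordinates[n [c [F cF]]]; exists n => tau e t m m0 Pe tP.
pose A : 'M[R]_(size t, n) := \matrix_(i, j) c t`_i 0 j.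
have /submxP[x xE] :
    ((const_mx 1 : 'rV_(size t)) *m A <= rowsub (maxrankfun A) A)%MS.
  by rewrite eq_maxrowsub submxMl.
pose y i : G := t`_(maxrankfun A i).
pose z i := Num.floor (x 0 i / m%:R).
have yt i : y i \in t by exact: mem_nth.
exists (\sum_i y i *~ z i); split.
  rewrite raddf_sum big1// => i _; rewrite raddfMz.
  by have [-> _ _] := tP _ (yt i); rewrite mul0rz.
move=> s sS; have [sT s1] := sS; have [_ _ s_ge0] := sT.
have [f sf] := trace_additive sT.
have sumE : s (\sum_(x <- t) x) = \sum_i x 0 i * s (y i).
  have sF g : s g = \sum_i c g 0 i * F i (SigSub (mem_set sS)).
    by rewrite -cF.
  rewrite (big_nth 0) big_mkord {1}sf raddf_sum -sf.
  under eq_bigr do rewrite sF.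
  under [RHS]eq_bigr do rewrite sF mulr_sumr.
  rewrite exchange_big [RHS]exchange_big; apply: eq_bigr => j _ /=.
  rewrite -mulr_suml; under [RHS]eq_bigr do rewrite mulrA.
  rewrite -mulr_suml; congr (_ * _).
  have := congr1 (fun v : 'rV_n => v 0 j) xE; rewrite !mxE.
  by under eq_bigr do rewrite !mxE mul1r; under [in RHS]eq_bigr do rewrite !mxE.
have -> : s (\sum_i y i *~ z i) = \sum_i s (y i) *~ z i.
  by rewrite sf raddf_sum; apply: eq_bigr => i _; rewrite raddfMz.
rewrite sumE -sumrMnl -sumrB.
have mR : 0 < m%:R :> R by rewrite ltr0n.
have se0 := s_ge0 _ Pe.
apply: (@le_trans _ _ (\sum_(i < \rank A) - (s e *+ m))).
  rewrite sumr_const card_ord mulrnA mulNrn lerN2 -!mulrnA.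
  by apply: ler_wpMn2l => //; rewrite leq_mul2l rank_leq_col orbT.
apply: ler_sum => i _.
have [_ /s_ge0 + /s_ge0] := tP _ (yt i); rewrite sf raddfB raddfD -sf.
rewrite subr_ge0 => h1 h2.
have := floor_itv (x 0 i / m%:R); rewrite -/(z i) intrD.
rewrite ler_pdivlMr// ltr_pdivrMr// => /andP[z1 z2].
rewrite -(mulr_natr (s e)) -(mulr_natr (s (y i) *~ z i)) -mulrzl -subr_ge0.
set zi : R := (z i)%:~R in z1 z2 *.
(* Every factor on the right is nonnegative, by the floor bounds [z1], [z2] and by
   [- s e <= s (y i)]. *)
have -> : x 0 i * s (y i) - zi * s (y i) * m%:R - - (s e * m%:R) =
    (x 0 i - zi * m%:R) * (s e + s (y i)) +
    ((zi + 1) * m%:R - x 0 i) * s e by ring.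
by rewrite addr_ge0 // mulr_ge0 // ?subr_ge0// ltW.
Qed.

End Traces.

(** * Unperforation of the cone enlarged by the kernel *)

Section RefinableTrace.
Context {R : realType} {G : zmodType} {P : set G} {u : G}.
Context {tau : {additive G -> R}}.
Hypotheses (dimP : simple_dimension_group P) (uP : order_unit P u).
Hypotheses (tauS : trace_space P u tau).
Implicit Types (a b e g k p x y : G) (s : G -> R).

Let Pmon : submonoid P := cone_submonoid dimP.
Let P0 : P 0 := Pmon.1.
Let PD : forall a b, P a -> P b -> P (a + b) := Pmon.2.
Let Pn a n : P a -> P (a *+ n). Proof. exact: submonoid_natmul. Qed.

Lemma kernel_cone_eq0 a : P a -> tau a = 0 -> a = 0.
Proof.
move=> Pa ta; apply: contrapT => /(trace_gt0 dimP tauS Pa).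
by rewrite ta ltxx.
Qed.

(** An atom would generate [G], and [tau], being positive at it, would be injective. *)
Lemma nontrivial_kernel_atomless k e : tau k = 0 -> k <> 0 -> P e -> e <> 0 ->
  exists x, [/\ P x, P (e - x), x <> 0 & x <> e].
Proof.
move=> tk k0 Pe e0; apply: contrapT => noatom; apply: k0.
have [|z kE] := @atom_generates _ _ dimP e k Pe e0.
  move=> x Px Pex; apply: contrapT => /not_orP[x0 xe].
  by apply: noatom; exists x.
have /eqP := tk; rewrite kE raddfMz -mulrzl mulf_eq0 intr_eq0.
move=> /orP[/eqP->//|].
by rewrite gt_eqF// (trace_gt0 dimP tauS).
Qed.

Hypothesis tau_refinable : refinable P [set (tau : G -> R)].

(** Refinability splits [k + a *+ m.+1] into [a1] and [a2] with the traces of [a] and [a *+ m]. The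
    piece [a1 - a] is taken off, and the induction goes on with [a2 - a *+ m]. *)
Lemma refine_kernel_element m a k : tau k = 0 -> P a -> P (k + a *+ m) ->
  exists t : seq G, k = \sum_(x <- t) x /\
    forall x, x \in t -> [/\ tau x = 0, P (x + a) & P (k + a *+ m - (x + a))].
Proof.
move=> + Pa; elim: m k => [|m IHm] k tk.
  by rewrite addr0 => /kernel_cone_eq0 ->//; exists [::]; rewrite big_nil.
set b := k + _ => Pb.
have [|a1 [a2 [Pa1 Pa2 ab a12]]] := tau_refinable Pa (Pn m Pa) Pb.
  by move=> _ ->; rewrite /b raddfD tk add0r !raddfMn mulrS.
have [ta1 ta2] := a12 _ erefl.
have [||t [tE tP]] := IHm (a2 - a *+ m).
- by rewrite raddfB ta2 subrr.
- by rewrite subrK.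
exists (a1 - a :: t); split.
  by rewrite big_cons -tE -[k](addrK (a *+ m.+1)) -/b -ab; zmod.
move=> x; rewrite inE => /orP[/eqP->|/tP[tx Pxa Pax]].
  rewrite raddfB ta1 subrr subrK; split=> //.
  by rewrite -ab addrAC subrr add0r.
split=> //; rewrite -ab.
have -> : a1 + a2 - (x + a) = a1 + (a2 - a *+ m + a *+ m - (x + a)) by zmod.
exact: PD.
Qed.

(* Writing [k = x - y] with [x, y] positive, [k] is first cut into pieces
   [z >= - a], where [a] is about [y / m]; the sum of the positive elements
   [z + a] is about [x].  Cutting each [- z] at [c], about [(z + a) / m], leaves
   pieces between [- c] and about [a]. *)
Lemma small_kernel_decomposition k e : tau k = 0 -> k <> 0 -> P e -> e <> 0 ->
  exists t : seq G, k = \sum_(x <- t) x /\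
    forall x, x \in t -> [/\ tau x = 0, P (e - x) & P (e + x)].
Proof.
move=> tk k0 Pe e0.
have atomless f : P f -> f <> 0 ->
    exists x, [/\ P x, P (f - x), x <> 0 & x <> f].
  exact: nontrivial_kernel_atomless tk k0.
have [Pu u0 _] := uP.
have [N Py] := cone_unit dimP k Pu u0.
have : P (u *+ N) by exact: Pn.
set x := u *+ N in Py *; set y := x - k in Py * => Px.
have [e1 [Pe1 e10 Pee1]] := small_fraction dimP atomless 2 Pe e0.
have [N1 PN1] := cone_unit dimP y Pe1 e10.
have [N2 PN2] := cone_unit dimP x Pe1 e10.
(* This [m] makes [e1 *+ m] exceed both [y + e1] and [x + e1 *+ 2], which forces the quotients [a]
   and [c] below [e1]. *)
pose m := (N1 + N2).+2.
have [//|a [Pa Pay Pya]] :=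
  @approximate_division _ _ dimP m y e1 atomless _ Py Pe1 e10.
have Pea : P (e1 - a).
  apply: (cone_unperforated dimP (n := m)) => //.
  have -> : (e1 - a) *+ m =
    (e1 *+ N1 - y) + (y + e1 - a *+ m) + e1 *+ N2.+1 by rewrite /m; zmod.
  by apply: PD; [exact: PD|exact: Pn].
have [|t [tE tP]] := @refine_kernel_element m a k tk Pa.
  have -> : k + a *+ m = x + (a *+ m - y) by rewrite /y; zmod.
  exact: PD.
rewrite tE; elim: t {tE} tP => [|z t IHt] tP; first by exists [::].
have [|t1 [t1E t1P]] := IHt.
  by move=> w wt; apply: tP; rewrite inE wt orbT.
have [|tz Pza Pkz] := tP z; first exact: mem_head.
have {}Pkz : P (x + e1 - (z + a)).
  have -> : x + e1 - (z + a) = (k + a *+ m - (z + a)) + (y + e1 - a *+ m).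
    by rewrite /y; zmod.
  exact: PD.
have [//|c [Pc Pcp Ppc]] :=
  @approximate_division _ _ dimP m (z + a) e1 atomless _ Pza Pe1 e10.
have Pec : P (e1 - c).
  apply: (cone_unperforated dimP (n := m)) => //.
  have -> : (e1 - c) *+ m = (z + a + e1 - c *+ m) + (x + e1 - (z + a)) +
    ((e1 *+ N2 - x) + e1 *+ N1) by rewrite /m; zmod.
  by apply: PD; [exact: PD|apply: PD => //; exact: Pn].
have [||t2 [t2E t2P]] := @refine_kernel_element m c (- z) _ Pc.
- by rewrite raddfN tz oppr0.
- have -> : - z + c *+ m = a + (c *+ m - (z + a)) by zmod.
  exact: PD.
exists ([seq - w | w <- t2] ++ t1); rewrite big_cons big_cat big_map sumrN -t2E.
rewrite opprK t1E; split=> // w; rewrite mem_cat => /orP[|/t1P//].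
move=> /mapP[{}w /t2P[tw Pwc Pzw] ->]; split; first by rewrite raddfN tw oppr0.
  have -> : e - - w = (w + c) + (e1 - c) + ((e - e1 *+ 2) + e1) by zmod.
  by apply: PD; exact: PD.
have -> : e - w = (- z + c *+ m - (w + c)) + c +
   ((z + a + e1 - c *+ m) + ((e1 - a) + (e - e1 *+ 2))) by zmod.
by apply: PD; [exact: PD|apply: PD => //; exact: PD].
Qed.

(** This is the sum of [P] and the kernel of [tau], since [tau p = tau g] means that [g - p] is in
    the kernel. *)
Definition kernel_cone : set G := [set g | exists2 p, P p & tau p = tau g].

Lemma kernel_cone_submonoid : submonoid kernel_cone.
Proof.
split; first by exists 0.
move=> a b [p Pp pa] [q Pq qb]; exists (p + q); first exact: PD.
by rewrite !raddfD pa qb.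
Qed.

(** A state that is nonnegative on [kernel_cone] is nonnegative at [k] and [- k] for each [k] in the
    kernel, so it vanishes there and belongs to [ker_face]. *)
Lemma kernel_cone_positive g : unperforated kernel_cone ->
  (forall s, ker_face P u tau s -> 0 < s g) -> kernel_cone g.
Proof.
move=> unp g_gt0; apply: contrapT => Kg; have [Pu u0 uu] := uP.
have PK p : P p -> kernel_cone p by exists p.
have [|n n0 Kgn|s [sD s0 s1 sg]] :=
    @state_exists R G _ u g kernel_cone_submonoid (PK _ Pu).
- by move=> h; have [N [_ Nh]] := uu h; exists N; exact: PK.
- exact/Kg/(unp n).
have s00 : s 0 = 0 by apply: (addrI (s 0)); rewrite -sD !addr0.
have s_ge0 k : tau k = 0 -> 0 <= s k.
  by move=> tk; apply: s0; exists 0; rewrite ?raddf0.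
have /g_gt0 : ker_face P u tau s; last by rewrite ltNge sg.
split.
  split=> //; split=> //; last by move=> h /PK/s0.
  by exists u; rewrite s1; apply/eqP/oner_neq0.
move=> k /=; rewrite inE => /eqP tk.
apply/eqP; rewrite eq_le s_ge0// andbT.
have : 0 <= s (- k) by apply: s_ge0; rewrite raddfN tk oppr0.
by rewrite -[X in _ -> s k <= X]s00 -(subrr k) sD lerDl.
Qed.

Lemma kernel_cone_unperforated : aff_finite_dimensional (R := R) P u ->
  unperforated kernel_cone.
Proof.
move=> /approximate_kernel_division[n approx] m g m0 [p Pp tpg].
have [p0|p0] := pselect (p = 0).
  exists 0; rewrite ?raddf0//; apply/eqP.
  by move/eqP: tpg; rewrite p0 raddf0 raddfMn eq_sym mulrn_eq0 gtn_eqF// eq_sym.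
pose k := g *+ m - p.
have tk : tau k = 0 by rewrite /k raddfB tpg subrr.
have [k0|k0] := pselect (k = 0).
  exists g => //; apply: (cone_unperforated dimP m0).
  by rewrite -[g *+ m](subrK p) -/k k0 add0r.
(* Of the [(m * n).+1] copies of [e] below [p], [m * n] absorb the error in [approx]; the last one
   makes the inequality on traces strict. *)
have [|e [Pe e0 Ppe]] := small_fraction dimP _ (m * n).+1 Pp p0.
  by move=> f; exact: nontrivial_kernel_atomless tk k0.
have [t [kE tP]] := small_kernel_decomposition tk k0 Pe e0.
have [k' [tk' k'P]] := approx tau e t m m0 Pe tP.
exists (g - k'); last by rewrite raddfB tk' subr0.
apply: (cone_unperforated dimP m0).
apply: (positive_on_traces (R := R) dimP uP) => s sS.
have [sT _] := sS; have [_ _ s_ge0] := sT.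
have se := trace_gt0 dimP sS Pe e0.
have [f sf] := trace_additive sT.
have := k'P _ sS; rewrite -kE; have := s_ge0 _ Ppe.
have -> : s (p - e *+ (m * n).+1) = s p - (s e + s e *+ (m * n)).
  by rewrite sf raddfB raddfMn mulrS.
have -> : s ((g - k') *+ m) = s p + s k - s k' *+ m.
  by rewrite sf -raddfMn -raddfD -raddfB; congr (f _); rewrite /k; zmod.
move: (s e *+ _) (s p) (s k) (s k' *+ m) se => A B C D; lra.
Qed.

End RefinableTrace.

(** * The quotient by the kernel of a refinable trace *)

Section QuotientGroup.
Context {R : realType} {G : zmodType} {P : set G} {u : G}.
Context {tau : {additive G -> R}}.
Hypotheses (dimP : simple_dimension_group P) (uP : order_unit P u).
Hypotheses (tauS : trace_space P u tau).
Hypothesis affP : aff_finite_dimensional (R := R) P u.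
Hypothesis tau_refinable : refinable P [set (tau : G -> R)].
Implicit Types (a b e g k p x y : G) (s : G -> R).

Let PD : forall a b, P a -> P b -> P (a + b) := (cone_submonoid dimP).2.

Local Notation Q := (Quotient.quot (ker tau)).
Local Notation cone := (quotient_cone P (ker tau)).

Local Notation pi := (\pi_Q%qT : G -> Q).

Lemma quotient_eqP x y : pi x = pi y <-> tau x = tau y.
Proof.
split=> [/eqP|txy].
  by rewrite -Quotient.idealrBE inE raddfB subr_eq0 => /eqP.
by apply/eqP; rewrite -Quotient.idealrBE inE raddfB txy subrr.
Qed.

Lemma quotient_coneP x : cone (pi x) <-> kernel_cone (P := P) (tau := tau) x.
Proof.
split.
  move=> [p Pp [h]]; rewrite /= inE => /eqP th /quotient_eqP.
  by rewrite raddfD th addr0 => tp; exists p.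
move=> [p Pp tp]; exists p => //; exists 0; rewrite /= ?inE ?raddf0//.
by apply/quotient_eqP; rewrite addr0.
Qed.

Lemma quotient_cone_pi x : P x -> cone (pi x).
Proof. by move=> Px; apply/quotient_coneP; exists x. Qed.

Lemma quotient_cone_le x y : cone_le cone (pi x) (pi y) <->
  kernel_cone (P := P) (tau := tau) (y - x).
Proof. by rewrite -quotient_coneP /cone_le raddfB. Qed.

Lemma quotient_po_group : po_group cone.
Proof.
split.
- by rewrite -(raddf0 pi); apply/quotient_cone_pi/(cone_submonoid dimP).1.
- move=> X Y; elim/quotW: X => x; elim/quotW: Y => y.
  move=> /quotient_coneP[p Pp px] /quotient_coneP[q Pq qy].
  rewrite -raddfD; apply/quotient_coneP; exists (p + q); first exact: PD.
  by rewrite !raddfD px qy.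
- move=> X; elim/quotW: X => x; rewrite -raddfN.
  move=> /quotient_coneP[p Pp px] /quotient_coneP[q Pq qx].
  have /(kernel_cone_eq0 dimP tauS (PD Pp Pq))/addr0_eq qE : tau (p + q) = 0.
    by rewrite raddfD px qx raddfN subrr.
  rewrite -(raddf0 pi); apply/quotient_eqP; rewrite -px.
  by rewrite (cone_anti dimP Pp) ?raddf0// qE.
Qed.

Lemma quotient_directed : directed cone.
Proof.
have [[_ Pdir _ _] _] := dimP.
move=> A finA; have [b bP] := Pdir _ (finite_image (fun X : Q => repr X) finA).
exists (pi b) => X AX; rewrite -[X]reprK; apply/quotient_cone_le.
by exists (b - repr X) => //; apply: bP; exists X.
Qed.

Lemma quotient_unperforated : unperforated cone.
Proof.
have unp := kernel_cone_unperforated dimP uP tauS tau_refinable affP.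
move=> m X m0; elim/quotW: X => x; rewrite -raddfMn.
by move=> /quotient_coneP/(unp _ _ m0)/quotient_coneP.
Qed.

(** The differences [bj - ai] lift to positive [pij] only up to the kernel. Refinability replaces
    [p12] and [p21] by [q12] and [q21] with sum exactly [p11 + p22]; then [p11 - q21] represents
    [a2 - a1], and interpolation in [G] applies to differences from [a1]. *)
Lemma quotient_interpolation : riesz_interpolation cone.
Proof.
have [[_ _ _ Pint] _] := dimP.
move=> A1 A2 B1 B2; elim/quotW: A1 => a1; elim/quotW: A2 => a2.
elim/quotW: B1 => b1; elim/quotW: B2 => b2.
move=> /quotient_cone_le[p11 P11 t11] /quotient_cone_le[p12 P12 t12].
move=> /quotient_cone_le[p21 P21 t21] /quotient_cone_le[p22 P22 t22].
have [|q12 [q21 [Q12 Q21 qE qt]]] := tau_refinable P12 P21 (PD P11 P22).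
  by move=> _ ->; rewrite raddfD t11 t12 t21 t22 !raddfB; ring.
have [q12t q21t] := qt _ erefl.
have [||||z [Pz Pqz Pz1 Pz2]] := Pint 0 (p11 - q21) p11 q12;
  rewrite /cone_le ?subr0//.
- by rewrite opprB addrC subrK.
- suff -> : q12 - (p11 - q21) = p22 by [].
  by rewrite opprB addrA qE addrAC subrr add0r.
rewrite /cone_le subr0 in Pz.
exists (pi (a1 + z)); split; apply/quotient_cone_le.
- by exists z => //; congr (tau _); zmod.
- exists (z - (p11 - q21)) => //.
  by rewrite !(raddfB tau, raddfD tau) q21t t11 t21 !(raddfB tau); ring.
- exists (p11 - z) => //.
  by rewrite !(raddfB tau, raddfD tau) t11 (raddfB tau); ring.
- exists (q12 - z) => //.
  by rewrite !(raddfB tau, raddfD tau) q12t t12 (raddfB tau); ring.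
Qed.

Lemma quotient_simple : simple_group cone.
Proof.
have [_ [_ _ PE]] := dimP; have [_ tu] := tauS.
split; first 1 last.
- exact: quotient_directed.
- apply/seteqP; split=> X; last first.
    by move=> [CX X0 _]; split.
  elim/quotW: X => x [/quotient_coneP[p Pp /quotient_eqP <-]] p0.
  have : (P `\ 0) p by split=> // p_eq0; apply: p0; rewrite p_eq0 raddf0.
  rewrite PE => -[_ _ punit]; split=> //; first exact: quotient_cone_pi.
  move=> Y; elim/quotW: Y => y; have [N [N1 N2]] := punit y; exists N.
  rewrite -raddfMn -raddfN.
  by split; rewrite /cone_le -raddfB; exact: quotient_cone_pi.
exists (pi u); rewrite -(raddf0 pi) => /quotient_eqP/eqP.
by rewrite tu raddf0 oner_eq0.
Qed.

End QuotientGroup.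

(** * Equivalence of the four conditions *)

Theorem theorem8p1 (R : realType) (G : zmodType) (P : set G) (u : G)
    (tau : {additive G -> R}) :
  simple_dimension_group P ->
  order_unit P u ->
  aff_finite_dimensional (R := R) P u ->
  trace_space P u tau ->
  let Z := ker_face P u tau in
  [<-> refinable P [set (tau : G -> R)];
       refinable P Z;
       good P Z;
       weakly_good P Z]
  /\
  (refinable P [set (tau : G -> R)] ->
     simple_dimension_group (quotient_cone P (ker tau)) /\
     unperforated (quotient_cone P (ker tau))).
Proof.
move=> dimP uP affP tauS Z.
have Zker s a b : Z s -> tau a = tau b -> s a = s b.
  move=> [[sT _] sker] tab; have [f sf] := trace_additive sT.
  apply/eqP; rewrite sf -subr_eq0 -raddfB -sf; apply/eqP/sker.
  by rewrite /= inE raddfB tab subrr.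
have Ztau : Z tau by split=> // g /=; rewrite inE => /eqP.
(* An [N] with [a *+ N] above [u] bounds all of [Z] below at [a] by the same constant [N%:R^-1]. *)
have Zinf a : P a -> a <> 0 -> 0 < inf [set s a | s in Z].
  move=> Pa a0; have [N PN] := cone_unit dimP u Pa a0.
  have Na s : Z s -> 1 <= s a *+ N.
    move=> [[sT s1] _]; have [_ _ s_ge0] := sT.
    have [f sf] := trace_additive sT.
    by have := s_ge0 _ PN; rewrite sf raddfB raddfMn -sf s1 subr_ge0.
  have N0 : (0 < N)%N.
    by rewrite lt0n; apply/eqP => N0; have := Na _ Ztau; rewrite N0 ler10.
  apply: (@lt_le_trans _ _ N%:R^-1); first by rewrite invr_gt0 ltr0n.
  apply: lb_le_inf; first by exists (tau a), tau.
  move=> _ [s Zs <-]; rewrite -div1r ler_pdivrMr ?ltr0n// mulr_natr.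
  exact: Na.
have inf_gt0 g : 0 < inf [set s g | s in Z] -> forall s, Z s -> 0 < s g.
  move=> g_gt0 s Zs; apply: (lt_le_trans g_gt0).
  apply: ge_inf; last by exists s.
  (* A lower bound is required, as [inf] of a set without one is a default value. *)
  have [_ _ /(_ g)[N [Ng _]]] := uP.
  exists (- N%:R) => _ [s' [[sT s1] _] <-].
  have [_ _ s_ge0] := sT; have [f sf] := trace_additive sT.
  by have := s_ge0 _ Ng; rewrite sf raddfB raddfN raddfMn -sf s1 subr_ge0.
have refine_tau : refinable P Z -> refinable P [set (tau : G -> R)].
  move=> Z_ref a1 a2 b P1 P2 Pb tab.
  have [|a1' [a2' [P1' P2' <- a12]]] := Z_ref a1 a2 b P1 P2 Pb.
    move=> s Zs; have [[sD _ _] _] := Zs.1.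
    by rewrite -sD; apply: Zker Zs _; rewrite raddfD tab.
  by exists a1', a2'; split=> // _ ->; exact: a12.
split; last first.
  move=> tau_ref.
  have unp := quotient_unperforated dimP uP tauS affP tau_ref.
  split=> //; split; last exact: quotient_simple dimP tauS.
  split=> //; first exact: quotient_po_group dimP tauS.
    exact: quotient_directed dimP.
  exact: quotient_interpolation dimP tau_ref.
tfae.
- move=> tau_ref a1 a2 b P1 P2 Pb Zab.
  have [|a1' [a2' [P1' P2' <- /(_ _ erefl)[t1 t2]]]] :=
      tau_ref a1 a2 b P1 P2 Pb.
    by move=> _ ->; exact: Zab.
  by exists a1', a2'; split=> // s Zs; split; exact: Zker.
- move=> /refine_tau tau_ref a b [Pb b0] a_gt0 ab_gt0.
  have unp := kernel_cone_unperforated dimP uP tauS tau_ref affP.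
  have [p Pp pa] := kernel_cone_positive dimP uP unp (inf_gt0 _ a_gt0).
  have {}ab_gt0 s : Z s -> 0 < s (b - a).
    apply: inf_gt0; move: ab_gt0; congr (0 < inf _).
    apply: eq_imagel => {}s [[/trace_additive[f ->] _] _].
    by rewrite raddfB.
  have [q Pq qba] := kernel_cone_positive dimP uP unp ab_gt0.
  (* Positive [p] and [q] with the traces of [a] and [b - a] are now available, so [b] can be
     refined along them. *)
  have [|a1 [a2 [P1 P2 ab ta]]] := tau_ref p q b Pp Pq Pb.
    by move=> _ ->; rewrite pa qba raddfB addrC subrK.
  have [t1 t2] := ta _ erefl; exists a1; split; last first.
  + by move=> s Zs; apply: Zker => //; rewrite t1 pa.
  + split; first by rewrite /cone_le -ab addrAC subrr add0r.
    move=> a1b; have : a2 = 0 by apply: (addrI a1); rewrite ab addr0.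
    move=> a20; have : 0 < tau a2; last by rewrite a20 raddf0 ltxx.
    by rewrite t2 qba ab_gt0.
  + split=> // a10; have := inf_gt0 _ a_gt0 _ Ztau.
    by rewrite -pa -t1 a10 raddf0 ltxx.
- by move=> Z_good a b [Pa a0] Pb ab; apply: Z_good => //; exact: Zinf.
- move=> Z_wgood a1 a2 b P1 P2 Pb tab.
  have P0 := (cone_submonoid dimP).1.
  have {}tab : tau (a1 + a2) = tau b 
    by rewrite raddfD; exact: tab.
  (* Weak goodness speaks of nonzero elements only, so zero summands are treated apart; for the
     others, [a2] is what makes the infimum of [s b - s a1] positive. *)
  have [a10|a10] := pselect (a1 = 0).
    rewrite a10 add0r in tab *; exists 0, b; split=> //; first by rewrite add0r.
    by move=> _ ->.
  have [a20|a20] := pselect (a2 = 0).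
    rewrite a20 addr0 in tab *; exists b, 0; split=> //; first by rewrite addr0.
    by move=> _ ->.
  have b0 : b <> 0.
    move=> b0; have := trace_gt0 dimP tauS P1 a10.
    have := trace_gt0 dimP tauS P2 a20; have /eqP := tab.
    by rewrite raddfD b0 raddf0 => /eqP; lra.
  have [||| a [[Pa _] [Pab _] ta]] := Z_wgood a1 b.
  + by split.
  + by split.
  + have := Zinf _ P2 a20; congr (0 < inf _); apply: eq_imagel => s Zs.
    have [[sD _ _] _] := Zs.1.
    by rewrite -(Zker _ _ _ Zs tab) sD addrAC subrr add0r.
  exists a, (b - a); split=> //; first by rewrite addrC subrK.
  by move=> _ ->; rewrite raddfB ta// -tab raddfD addrAC subrr add0r.
Qed.
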